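(* We have $$\liminf_{n\to\infty}\frac{\mathcal{C}(\mathbb{Z}/n\mathbb{Z})}{n}=0,\qquad \limsup_{n\to\infty}\frac{\mathcal{C}(\mathbb{Z}/n\mathbb{Z})}{n}=1.$$ In particular, the limit $\lim_{n\to\infty}\mathcal{C}(\mathbb{Z}/n\mathbb{Z})/n$ does not exist.
   Context: For an element $x$ of a finite group $G$, $\operatorname{ord}(x)$ denotes its order (for $\mathbb{Z}/n\mathbb{Z}$, the additive order). A nonempty subset $S\subseteq G$ is called a Chowla set if $\operatorname{ord}(x)>|S|$ for every $x\in S$. Define $\mathcal{C}(G)=\max\{|S|:S\subseteq G\text{ is a Chowla set}\}$. The variable $n$ ranges over integers $n\ge 2$. *)

(* Defs.v *)
From HB Require Import structures.
From mathcomp Require Import all_boot all_order all_algebra all_fingroup.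
From mathcomp Require Import all_classical all_reals all_analysis.

Set Implicit Arguments.
Unset Strict Implicit.
Unset Printing Implicit Defensive.

Import Order.TTheory GRing.Theory Num.Theory.
Import numFieldNormedType.Exports.

Local Open Scope ring_scope.

Definition chowla_set (gT : finGroupType) (S : {set gT}) : bool :=
  (S != finset.set0) && [forall x in S, (#|S| < #[x]%g)%N].

(* A trivial group has no Chowla set; the maximum is then 0. *)
Definition chowla_number (gT : finGroupType) : nat :=
  \max_(S : {set gT} | chowla_set S) #|S|.

(* The term of index k is the ratio for n = k + 2, so that n ranges exactly
   over the integers n >= 2. The finGroupType structure on 'Z_n is the additive
   one, so #[x] is the additive order. *)
Definition chowla_ratio (R : realType) : R^nat :=
  fun k => (chowla_number 'Z_k.+2)%:R / k.+2%:R.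

(* Main.v *)
Require Import Defs.
From HB Require Import structures.
From mathcomp Require Import all_boot all_order all_algebra all_fingroup.
From mathcomp Require Import cyclic.
From mathcomp Require Import all_classical all_reals all_analysis.

Set Implicit Arguments.
Unset Strict Implicit.
Unset Printing Implicit Defensive.

Import Order.TTheory GRing.Theory Num.Theory.
Import numFieldNormedType.Exports.

(** Every ratio lies in [0, 1], so the two limits follow once the ratios come
close to 0 and close to 1 for arbitrarily large n.

Close to 1: in a group of prime order p every nontrivial element has order p,
so the p - 1 nontrivial elements form a Chowla set ([chowla_number_prime]).

Close to 0: take n = N! J!. Let S be a Chowla set of Z/nZ with |S| > n / J. All
its elements have order larger than n / J, hence order n / j for some j <= J,
and a cyclic group has at most totient (n / j) elements of that order
([chowla_set_cyclic_card]). It remains to see that totient m / m is small for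
each m = n / j, and all of these are multiples of N!. Write H_N for
1 + 1/2 + ... + 1/N. For m divisible by 1, ..., N, the identity m =
\sum_(d | m) totient d, restricted to the divisors d = m / i with i <= N,
together with totient m <= i * totient (m / i), gives
  m >= \sum_(i <= N) totient (m / i) >= totient m * H_N
([totient_harmonic_le]). Hence |S| <= \sum_(j <= J) (n / j) / H_N <= n J / H_N.
In all cases |S| <= n max(1 / J, J / H_N); choosing J large and then N large
makes the ratio small, because the harmonic series diverges
([chowla_ratio_small]). *)

Local Open Scope classical_set_scope.
Local Open Scope ring_scope.

Lemma sum_nat_coprime_period b a :
  (\sum_(0 <= d < a * b) coprime b d = a * totient b)%N.
Proof.
elim: a => [|a IHa]; first by rewrite !mul0n big_nil.
rewrite mulSnr (big_cat_nat (n := (a * b)%N)) ?leq_addr//= IHa mulSnr.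
congr (_ + _)%N; rewrite -{1}[(a * b)%N]add0n big_addn addKn.
by rewrite totient_count_coprime; apply: eq_bigr => d _; rewrite /coprime addnC gcdnMDl.
Qed.

(** Being prime to [a * b] is stronger than being prime to [b], and the latter
condition is [b]-periodic, so it holds [a * totient b] times below [a * b]. *)
Lemma leq_totientM a b : (totient (a * b) <= a * totient b)%N.
Proof.
rewrite totient_count_coprime -sum_nat_coprime_period.
by apply: leq_sum => d _; rewrite coprimeMl; case: (coprime a d).
Qed.

(** The [n %/ i.+1] are distinct divisors of [n], and the totients of all the
divisors of [n] add up to [n]. *)
Lemma leq_sum_totient_divn n N :
  (0 < n)%N -> (forall i, (i < N)%N -> i.+1 %| n)%N ->
  (\sum_(i < N) totient (n %/ i.+1) <= n)%N.
Proof.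
move=> n_gt0 dvdNn.
pose f (i : 'I_N) : 'I_n.+1 := inord (n %/ i.+1).
have fE i : f i = (n %/ i.+1)%N :> nat by rewrite inordK// ltnS leq_div.
have f_inj : injective f.
  move=> i j /(congr1 val); rewrite /= !fE => eqij.
  apply/val_inj/succn_inj => /=.
  have := divnK (dvdNn _ (ltn_ord i)); rewrite eqij.
  rewrite -{2}(divnK (dvdNn _ (ltn_ord j))) => /eqP.
  by rewrite eqn_pmul2l ?divn_gt0 ?(dvdn_leq n_gt0) ?dvdNn// => /eqP.
rewrite -[leqRHS]sum_totient_dvd.
under eq_bigr do rewrite -fE.
rewrite -(big_imset (fun d : 'I_n.+1 => totient d)); last by move=> i j _ _ /f_inj.
rewrite [leqRHS](bigID (mem (f @: 'I_N)%SET))/=.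
apply: (leq_trans _ (leq_addr _ _)).
rewrite [leqLHS]big_mkcond [leqRHS]big_mkcond; apply: leq_sum => d _.
case: ifP => // /imsetP[i _ ->].
by rewrite fE dvdn_div ?dvdNn// imset_f.
Qed.

(** A quantitative form of the fact that [totient n / n] can be arbitrarily
small; the argument makes no reference to the distribution of primes. *)
Lemma totient_harmonic_le (R : realType) n N :
  (0 < n)%N -> (N`! %| n)%N ->
  (totient n)%:R * series harmonic N <= n%:R :> R.
Proof.
move=> n_gt0 dvdNn.
have dvdin i : (i < N)%N -> (i.+1 %| n)%N.
  by move=> iN; apply: dvdn_trans dvdNn; rewrite dvdn_fact.
apply: (@le_trans _ _ (\sum_(i < N) totient (n %/ i.+1))%:R); last first.
  by rewrite ler_nat leq_sum_totient_divn.
rewrite seriesEord mulr_sumr natr_sum ler_sum// => i _ /=.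
rewrite ler_pdivrMr ?ltr0n// -natrM ler_nat mulnC.
by rewrite -{1}(divnK (dvdin i (ltn_ord i))) mulnC leq_totientM.
Qed.

(** In a cyclic group, two elements of the same order generate the same
subgroup, so all the elements of order [d] are generators of one cyclic group
of order [d]. *)
Lemma card_order_cyclic (gT : finGroupType) (G : {group gT}) d :
  cyclic G -> (#|[set x in G | #[x]%g == d]%SET| <= totient d)%N.
Proof.
move=> cycG.
have [->|[a]] := set_0Vmem [set x in G | #[x]%g == d]%SET; first by rewrite cards0.
rewrite inE => /andP[aG /eqP <-]; rewrite totient_gen; apply: subset_leq_card.
apply/fintype.subsetP => x; rewrite !inE => /andP[xG /eqP oxa].
by rewrite /generator (eq_subG_cyclic cycG) ?cycle_subG// -!orderE oxa.
Qed.

(** If [#|S| > #|gT| / J], the order of an element of [S] is more than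
[#|gT| / J], so the cofactor of this order in [#|gT|] is at most [J]. *)
Lemma chowla_set_cyclic_card (gT : finGroupType) (S : {set gT}) J :
  cyclic [set: gT]%SET -> chowla_set S ->
  (#|S| * J <= #|gT|)%N || (#|S| <= \sum_(j < J) totient (#|gT| %/ j.+1))%N.
Proof.
move=> cycG /andP[_ /forall_inP ordS].
case: leqP => //= ltS.
pose A j := [set x in [set: gT]%SET | #[x]%g == (#|gT| %/ j.+1)%N]%SET.
have /subset_leq_card/leq_trans : S \subset (\bigcup_(j < J) A j)%SET.
  apply/fintype.subsetP => x xS.
  (* q is the index of <[x]>, so x belongs to the member A q.-1 of the union. *)
  have /dvdnP[q gTE] : (#[x]%g %| #|gT|)%N by rewrite -cardsT order_dvdG ?inE.
  have q_gt0 : (0 < q)%N.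
    by case: q gTE => //; rewrite mul0n -cardsT => /eqP; rewrite eqn0Ngt cardG_gt0.
  have qJ : (q.-1 < J)%N.
    rewrite prednK// ltnW// -(ltn_pmul2r (order_gt0 x)) -gTE.
    by apply: leq_trans ltS _; rewrite mulnC leq_mul2l ltnW ?orbT ?ordS.
  apply/finset.bigcupP; exists (Ordinal qJ) => //.
  by rewrite !inE /= prednK// gTE mulKn.
apply; elim/big_rec2: _ => [|j m B _ leB]; first by rewrite cards0.
rewrite (leq_trans (leq_card_setU _ _).1)// leq_add//.
exact: card_order_cyclic.
Qed.

Lemma chowla_number_lt (gT : finGroupType) :
  (chowla_number gT < #|gT|)%N.
Proof.
have gT_gt0 : (0 < #|gT|)%N by rewrite -cardsT cardG_gt0.
rewrite -(prednK gT_gt0) ltnS; apply/bigmax_leqP => S /andP[/set0Pn[x xS]].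
move=> /forall_inP/(_ x xS) ltS; rewrite -ltnS prednK//.
by apply: leq_trans ltS _; rewrite dvdn_leq// -cardsT order_dvdG ?inE.
Qed.

Lemma chowla_number_prime (gT : finGroupType) :
  prime #|gT| -> chowla_number gT = #|gT|.-1.
Proof.
move=> pr_gT; apply/eqP; rewrite eqn_leq; apply/andP; split.
  by rewrite -ltnS prednK ?prime_gt0// chowla_number_lt.
have cardS : #|[set~ 1%g : gT]%SET| = #|gT|.-1 by rewrite cardsC1.
rewrite -cardS leq_bigmax_cond//; apply/andP; split.
  by rewrite -card_gt0 cardS -subn1 subn_gt0 prime_gt1.
apply/forall_inP => x; rewrite !inE -order_eq1 cardS => ox_neq1.
have : (#[x]%g %| #|gT|)%N by rewrite -cardsT order_dvdG ?inE.
move=> /(prime_nt_dvdP pr_gT ox_neq1) ->.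
by rewrite prednK// prime_gt0.
Qed.

Lemma limn_einf_eq (R : realType) (u : R^nat) (l : R) :
  (forall k, l <= u k) ->
  (forall e, 0 < e -> forall m, exists2 k, (m <= k)%N & u k < l + e) ->
  limn_einf (fun k => (u k)%:E) = l%:E.
Proof.
move=> ul ltu; rewrite limn_einf_lim.
suff -> : einfs (fun k => (u k)%:E) = cst l%:E by rewrite lim_cst.
apply/funext => m; apply/eqP; rewrite eq_le; apply/andP; split.
  apply/lee_addgt0Pr => e e0; have [k mk uk] := ltu e e0 m.
  apply: (@le_trans _ _ (u k)%:E); last by rewrite -EFinD lee_fin ltW.
  by apply: ereal_inf_lbound; exists k.
by apply: le_ereal_inf_tmp => _ [k _ <-]; rewrite lee_fin.
Qed.

Lemma limn_esup_eq (R : realType) (u : R^nat) (l : R) :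
  (forall k, u k <= l) ->
  (forall e, 0 < e -> forall m, exists2 k, (m <= k)%N & l - e < u k) ->
  limn_esup (fun k => (u k)%:E) = l%:E.
Proof.
move=> ul ltu; apply: oppe_inj; rewrite -limn_einfN -EFinN.
apply: (@limn_einf_eq _ (fun k => - u k)) => [k|e e0 m]; first by rewrite lerN2.
by have [k mk uk] := ltu e e0 m; exists k => //; rewrite ltrNl opprD opprK.
Qed.

Lemma card_Zn k : #|'Z_k.+2| = k.+2.
Proof. exact: card_ord. Qed.

Lemma cyclic_Zn k : cyclic [set: 'Z_k.+2]%SET.
Proof. by rewrite (Zp_cycle k.+1) cycle_cyclic. Qed.

(** The two bounds on [#|S|] in [chowla_set_cyclic_card] are made smaller than
[e * #|gT|] by the hypotheses on [J] and on [N] respectively. The factor [J`!]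
in the divisibility hypothesis ensures that every [#|gT| %/ j.+1] with [j < J]
is still divisible by [N`!], so that [totient_harmonic_le] applies to it. *)
Lemma chowla_number_cyclic_lt (R : realType) (gT : finGroupType) (e : R) J N :
  cyclic [set: gT]%SET -> (0 < J)%N -> J%:R^-1 < e -> J%:R < e * series harmonic N ->
  (N`! * J`! %| #|gT|)%N ->
  (chowla_number gT)%:R < e * #|gT|%:R.
Proof.
move=> cycG J_gt0 Je JN dvdn.
have gT_gt0 : (0 < #|gT|)%N by rewrite -cardsT cardG_gt0.
have J0 : 0 < J%:R :> R by rewrite ltr0n.
have e0 : 0 < e by apply: lt_trans Je; rewrite invr_gt0.
have H0 : 0 < series (@harmonic R) N by rewrite -(pmulr_rgt0 _ e0) (lt_trans _ JN).
have n0 : 0 < #|gT|%:R :> R by rewrite ltr0n.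
rewrite /chowla_number; elim/big_ind: _ => [|x y xe ye|S chS].
- by rewrite mulr_gt0.
- by rewrite /maxn; case: ifP.
have /orP[leS|leS] := chowla_set_cyclic_card J cycG chS.
  apply: (@le_lt_trans _ _ (J%:R^-1 * #|gT|%:R)); last by rewrite ltr_pM2r.
  by rewrite mulrC ler_pdivlMr// -natrM ler_nat.
rewrite -(ltr_pM2r H0); apply: (@le_lt_trans _ _ (J%:R * #|gT|%:R)); last first.
  by rewrite mulrAC ltr_pM2r.
apply: (@le_trans _ _ ((\sum_(j < J) totient (#|gT| %/ j.+1))%:R * series harmonic N)).
  by rewrite ler_pM2r// ler_nat.
have -> : J%:R * #|gT|%:R = \sum_(j < J) #|gT|%:R :> R.
  by rewrite sumr_const card_ord mulr_natl.
rewrite natr_sum mulr_suml; apply: ler_sum => j _.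
have dvdj : (j.+1 %| J`!)%N by rewrite dvdn_fact// ltn_ord.
apply: (@le_trans _ _ (#|gT| %/ j.+1)%:R); last by rewrite ler_nat leq_div.
have jn : (j.+1 %| #|gT|)%N by apply: dvdn_trans dvdn; rewrite dvdn_mull.
apply: totient_harmonic_le; first by rewrite divn_gt0// dvdn_leq.
by rewrite dvdn_divRL// (dvdn_trans _ dvdn)// dvdn_mul.
Qed.

Lemma chowla_ratio_small (R : realType) (e : R) m :
  0 < e -> exists2 k, (m <= k)%N & chowla_ratio R k < e.
Proof.
move=> e0.
have [J J_gt0 Je] : exists2 J, (0 < J)%N & J%:R^-1 < e.
  exists (Num.trunc e^-1).+1 => //.
  rewrite invf_plt ?posrE//; exact: truncnS_gt.
have Hy : series (@harmonic R) @ \oo --> +oo.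
  apply: nondecreasing_dvgn_lt (@dvg_harmonic R).
  by apply: nondecreasing_series => n _ _; exact: harmonic_ge0.
have /cvgryPgt/(_ (J%:R / e))[N0 _ HN] := Hy.
(* N0 makes the harmonic sum large enough; m.+2 makes n.-2 >= m. *)
pose N := maxn N0 m.+2; pose n := (N`! * J`!)%N.
have le_n : (m.+2 <= n)%N.
  apply: (leq_trans (leq_maxr N0 m.+2)); apply: (leq_trans (fact_geq N)).
  by rewrite leq_pmulr// fact_gt0.
have nE : n.-2.+2 = n by rewrite -(subnK (leq_trans _ le_n : 2 <= n)%N)// addn2.
exists n.-2; first by rewrite -2!ltnS nE.
rewrite /chowla_ratio ltr_pdivrMr ?ltr0n// -[in X in _ < X]card_Zn.
apply: (@chowla_number_cyclic_lt _ _ _ J N) => //.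
- exact: cyclic_Zn.
- by rewrite mulrC -ltr_pdivrMr//; apply: HN; exact: leq_maxl.
- by rewrite card_Zn nE.
Qed.

Lemma chowla_ratio_large (R : realType) (e : R) m :
  0 < e -> exists2 k, (m <= k)%N & 1 - e < chowla_ratio R k.
Proof.
move=> e0; have [p mp pr_p] := prime_above (maxn (Num.trunc e^-1) m.+1).
have pE : p.-2.+2 = p by case: p pr_p {mp} => [|[]].
have [ltp mltp] : (Num.trunc e^-1 < p)%N /\ (m.+1 < p)%N.
  by apply/andP; rewrite -gtn_max.
exists p.-2; first by rewrite -2!ltnS pE.
(* The ratio is 1 - p^-1, and p was chosen larger than e^-1. *)
rewrite /chowla_ratio chowla_number_prime card_Zn pE//.
have p0 : 0 < p%:R :> R by rewrite ltr0n prime_gt0.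
rewrite ltr_pdivlMr// mulrBl mul1r -subn1 natrB ?prime_gt0//.
rewrite ltrD2l ltrN2 -ltr_pdivrMl// mulr1.
apply: lt_le_trans (truncnS_gt _) _; by rewrite ler_nat.
Qed.

Theorem proposition2p13 (R : realType) :
  [/\ limn_einf (fun k => (chowla_ratio R k)%:E) = 0%:E,
      limn_esup (fun k => (chowla_ratio R k)%:E) = 1%:E
    & ~ cvgn (chowla_ratio R)].
Proof.
have einf0 : limn_einf (fun k => (chowla_ratio R k)%:E) = 0%:E.
  apply: limn_einf_eq => [k|e e0 m]; first by rewrite divr_ge0.
  by rewrite add0r; exact: chowla_ratio_small.
have esup1 : limn_esup (fun k => (chowla_ratio R k)%:E) = 1%:E.
  apply: limn_esup_eq => [k|e e0 m]; last exact: chowla_ratio_large.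
  rewrite ler_pdivrMr ?ltr0n// mul1r ler_nat -[leqRHS]card_Zn.
  exact/ltnW/chowla_number_lt.
(* A limit would be equal to both the lower and the upper limit. *)
split=> // /cvg_ex[l cvl].
have cvlE : (chowla_ratio R k)%:E @[k --> \oo] --> l%:E by apply: cvg_EFin cvl; exact: nearW.
have [] := cvg_limn_einf_sup cvlE; rewrite einf0 esup1 => <- [/eqP].
by rewrite oner_eq0.
Qed.
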